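(* Let $q\in\mathbb{Q}$ with $0<q<\tfrac12$ have odd denominator, i.e. $q=\frac{t}{2k+1}$ in lowest terms for some $k\in\mathbb{N}$ and $t\in\{1,2,\dots,k\}$. Let $p=\min\{d\in\mathbb{N}\mid 2^d\equiv\pm1 \bmod (2k+1)\}$, and let $\varepsilon_i=\dfrac{\cos 2^iq\pi}{|\cos 2^iq\pi|}$ for $i=1,2,\dots,p$. Define the sequence $(s_n)_{n\ge0}$ by $s_0=\sqrt2$ and $$s_{pn+i}=\sqrt{2+\varepsilon_{p+1-i}\,s_{pn+i-1}}\qquad\text{for } n\in\mathbb{N}\cup\{0\},\ i\in\{1,2,\dots,p\}.$$ Then $$\frac{1}{\pi}\cdot\frac{2\cos 2q\pi}{(1-4q)\sin q\pi}=\left(\frac{2\cos q\pi+\sqrt2}{2}\right)\prod_{i=0}^{\infty}\ \prod_{j=1}^{p}\left(\frac{|2\cos 2^{p-j}q\pi|+s_{pi+j}}{2}\right).$$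
   Context: $\mathbb{N}=\{1,2,3,\dots\}$. Square roots are nonnegative. The infinite product is $\lim_{N\to\infty}\prod_{i=0}^{N}\left(\prod_{j=1}^{p}\cdots\right)$. The number $p$ is the minimal period of the continued radical representation $2\cos q\pi=\sqrt{2+\varepsilon_1\sqrt{2+\varepsilon_2\sqrt{2+\cdots}}}$. Here $\cos 2^iq\pi$ means $\cos(2^iq\pi)$, and similarly for the other trigonometric expressions. *)

(* Defs.v *)
From HB Require Import structures.
From mathcomp Require Import all_boot all_order all_algebra.
From mathcomp Require Import all_classical all_reals all_analysis.

Set Implicit Arguments.
Unset Strict Implicit.
Unset Printing Implicit Defensive.

Import Order.TTheory GRing.Theory Num.Theory.
Import numFieldNormedType.Exports.
Local Open Scope ring_scope.

Definition pow2_pm1 (m d : nat) : Prop :=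
  (2 ^+ d = 1 %[mod m%:Z])%Z \/ (2 ^+ d = - 1 %[mod m%:Z])%Z.

Definition min_pow2_pm1 (m p : nat) : Prop :=
  [/\ (0 < p)%N, pow2_pm1 m p &
      forall d : nat, (0 < d)%N -> pow2_pm1 m d -> (p <= d)%N].

Definition cos_pow2 (R : realType) (q : rat) (i : nat) : R :=
  cos (2 ^+ i * ratr q * pi).

(* Division by zero does not occur: 2 ^ i * q is never half an odd integer when
   q has an odd denominator. *)
Definition radical_sign (R : realType) (q : rat) (i : nat) : R :=
  cos_pow2 R q i / `|cos_pow2 R q i|.

(* For p > 0 every positive index is p * n + i for exactly one n and one i in
   {1, ..., p}, so the sequence is uniquely determined. *)
Definition radical_seq (R : realType) (q : rat) (p : nat) (s : nat -> R) : Prop :=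
  s 0%N = Num.sqrt 2 /\
  forall n i : nat, (1 <= i <= p)%N ->
    s (p * n + i)%N =
    Num.sqrt (2 + radical_sign R q (p + 1 - i) * s (p * n + i - 1)%N).

Definition partial_product (R : realType) (q : rat) (p : nat) (s : nat -> R)
    (N : nat) : R :=
  \prod_(0 <= i < N.+1) \prod_(1 <= j < p.+1)
    ((`|2 * cos_pow2 R q (p - j)| + s (p * i + j)%N) / 2).

(* Main.v *)
Require Import Defs.
From HB Require Import structures.
From mathcomp Require Import all_boot all_order all_algebra.
From mathcomp Require Import all_classical all_reals all_analysis.
From mathcomp Require Import ring lra zify.

Set Implicit Arguments.
Unset Strict Implicit.
Unset Printing Implicit Defensive.

Import Order.TTheory GRing.Theory Num.Theory.
Import numFieldNormedType.Exports.
Local Open Scope ring_scope.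

(** Put c_i = cos (2 ^ i q pi).  The duplication formula gives
    |2 c_i| = sqrt (2 + 2 c_{i+1}), and 2 ^ p = +-1 modulo the denominator
    gives |c_p| = |c_0|.  Read backwards from c_p and extended p-periodically,
    the numbers |2 c_i| therefore form a sequence u with
    u_{m+1} = sqrt (2 + e_m u_m), for the very signs e_m that drive s.  The
    product thus compares two orbits of one recursion: the periodic one, u,
    starting at 2 cos (q pi), and s, starting at sqrt 2 = 2 cos (pi / 4).

    Two remarks evaluate it.  First, squaring the recursion gives
    u_{m+1}^2 - s_{m+1}^2 = e_m (u_m - s_m), so the product of the
    (u_{m+1} + s_{m+1}) / 2 telescopes to E (u_0 - s_0) / (2 ^ M (u_M - s_M)),
    where E = +-1 is the product of the M signs (radical_prod_telescope).
    Second, with x |-> 2 cos x as coordinate the recursion becomes affine of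
    slope +-1/2, so after M steps the angles of u and s differ by
    E / 2 ^ M times their initial difference (radical_angleB).  When p divides
    M the angle of u is again q pi, so E 2 ^ M (u_M - s_M) is a constant
    times a difference quotient of cos at q pi, and the product converges to
    (cos (q pi) - cos (pi / 4)) / ((pi / 4 - q pi) sin (q pi))
    (cvg_radical_prod).  The prefactor (2 cos (q pi) + sqrt 2) / 2 turns the
    numerator into a multiple of
    cos (q pi) ^ 2 - cos (pi / 4) ^ 2 = cos (2 q pi) / 2.

    The odd denominator also keeps every c_i nonzero (cos_pow2_neq0).  Hence the
    signs are defined, and u_0 <> s_0, so that no division above is by zero. *)

(** * Nested radicals as affine maps on angles *)

Section Radicals.
Variables (R : realType) (e : nat -> R).
Hypothesis e_sqr1 : forall m, e m ^+ 2 = 1.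

Lemma sqrt_two_cos (x : R) : - pi <= x <= pi ->
  Num.sqrt (2 + 2 * cos x) = 2 * cos (x / 2).
Proof.
move=> /andP[x_ge x_le].
have -> : 2 + 2 * cos x = (2 * cos (x / 2)) ^+ 2.
  have -> : cos x = cos (x / 2 *+ 2) by congr cos; rewrite -mulr_natr; field.
  by rewrite cos_mulr2n; ring.
rewrite sqrtr_sqr ger0_norm// mulr_ge0// cos_ge0_pihalf//.
by apply/andP; split; lra.
Qed.

(** For s = 1 the new angle is x / 2; for s = -1 it is (pi - x) / 2, because
    - cos x = cos (pi - x).  Writing both as pi / 4 + s (x / 2 - pi / 4) makes
    the dependence on s linear. *)
Lemma sqrt_two_sign_cos (s x : R) : s ^+ 2 = 1 -> 0 <= x <= pi / 2 ->
  Num.sqrt (2 + s * (2 * cos x)) = 2 * cos (pi / 4 + s * (x / 2 - pi / 4)).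
Proof.
have pi0 := pi_gt0 R.
move=> /eqP; rewrite sqrf_eq1 => /orP[] /eqP-> /andP[x_ge x_le].
  rewrite !mul1r sqrt_two_cos; last by apply/andP; split; lra.
  by congr (2 * cos _); ring.
have -> : -1 * (2 * cos x) = 2 * cos (pi - x).
  by rewrite -[pi - x]addrC cosDpi cosN; ring.
rewrite sqrt_two_cos; last by apply/andP; split; lra.
by congr (2 * cos _); field.
Qed.

Fixpoint radical_angle (x : R) (m : nat) : R :=
  if m is m'.+1 then pi / 4 + e m' * (radical_angle x m' / 2 - pi / 4) else x.

Lemma radical_angle_bounds (x : R) m : 0 <= x <= pi / 2 ->
  0 <= radical_angle x m <= pi / 2.
Proof.
move=> x_bounds; elim: m => //= m /andP[ge0 le_pihalf].
have /eqP := e_sqr1 m; have pi0 := pi_gt0 R.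
by rewrite sqrf_eq1 => /orP[] /eqP->; apply/andP; split; lra.
Qed.

Lemma radical_seq_cos (x : R) (u : nat -> R) : 0 <= x <= pi / 2 ->
  u 0%N = 2 * cos x ->
  (forall m, u m.+1 = Num.sqrt (2 + e m * u m)) ->
  forall m, u m = 2 * cos (radical_angle x m).
Proof.
move=> x_bounds u0 uS; elim=> //= m IH.
by rewrite uS IH sqrt_two_sign_cos// radical_angle_bounds.
Qed.

Definition sign_prod m : R := \prod_(0 <= l < m) e l.

Lemma sign_prod_sqr m : sign_prod m ^+ 2 = 1.
Proof. by rewrite /sign_prod -prodrXl big1. Qed.

(** Each step is affine in the angle with slope e_m / 2, so the constant terms
    cancel in a difference. *)
Lemma radical_angleB (x y : R) m :
  radical_angle x m - radical_angle y m = sign_prod m / 2 ^+ m * (x - y).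
Proof.
elim: m => [|m IH] /=; first by rewrite /sign_prod big_nil expr0; field.
rewrite /sign_prod big_nat_recr//= -/(sign_prod m) exprS.
transitivity (e m / 2 * (radical_angle x m - radical_angle y m)); first by field.
rewrite IH; field.
by rewrite expf_neq0.
Qed.

Lemma sqr_radicalS (x : R) (u : nat -> R) : 0 <= x <= pi / 2 ->
  u 0%N = 2 * cos x ->
  (forall m, u m.+1 = Num.sqrt (2 + e m * u m)) ->
  forall m, u m.+1 ^+ 2 = 2 + e m * u m.
Proof.
move=> x_bounds u0 uS m; rewrite uS sqr_sqrtr//.
rewrite (radical_seq_cos x_bounds u0 uS).
have := cos_geN1 (radical_angle x m); have := cos_le1 (radical_angle x m).
by have /eqP := e_sqr1 m; rewrite sqrf_eq1 => /orP[] /eqP->; lra.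
Qed.

(** Multiplying u_{m+1} - v_{m+1} by u_{m+1} + v_{m+1} gives back
    e_m (u_m - v_m).  The identity is stated without division, as u and v may
    coincide. *)
Lemma radical_prod_telescope (u v : nat -> R) :
  (forall m, u m.+1 ^+ 2 = 2 + e m * u m) ->
  (forall m, v m.+1 ^+ 2 = 2 + e m * v m) ->
  forall m, 2 ^+ m * (u m - v m) * \prod_(0 <= l < m) ((u l.+1 + v l.+1) / 2) =
            sign_prod m * (u 0%N - v 0%N).
Proof.
move=> uS vS; elim=> [|m IH]; first by rewrite /sign_prod !big_nil expr0; ring.
rewrite /sign_prod !big_nat_recr//= -/(sign_prod m).
transitivity (2 ^+ m * (u m.+1 ^+ 2 - v m.+1 ^+ 2) *
  \prod_(0 <= l < m) ((u l.+1 + v l.+1) / 2)); first by rewrite exprS; field.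
rewrite uS vS.
transitivity (e m * (2 ^+ m * (u m - v m) *
  \prod_(0 <= l < m) ((u l.+1 + v l.+1) / 2))); first by ring.
by rewrite IH; ring.
Qed.

(** * The limit of the telescoped product *)

Local Open Scope classical_set_scope.

Lemma cvg_cos_quotient (x : R) (h : nat -> R) : (forall n, h n != 0) ->
  h n @[n --> \oo] --> 0 ->
  (cos (x + h n) - cos x) / h n @[n --> \oo] --> - sin x.
Proof.
move=> h_neq0 h0.
have [dcos <-] := is_derive_cos x.
have h0' : h n @[n --> \oo] --> (0 : R)^'.
  move=> A; rewrite /dnbhs /within /= => A0.
  have hA : \forall n \near \oo, h n != 0 -> A (h n) := h0 _ A0.
  by rewrite nbhs_filterE /fmap /=; apply: filterS hA => n; exact.
have := cvg_comp _ _ h0' dcos.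
apply: cvg_trans; apply: near_eq_cvg; apply: nearW => n /=.
by rewrite [_%:A + x]addrC /GRing.scale /= mulr1 mulrC.
Qed.

(** The indices M n are times at which u returns to its starting point.  Only
    along them is the telescoped product governed by a difference quotient of
    cos at a fixed point, namely x. *)
Lemma cvg_radical_prod (x y : R) (u v : nat -> R) (M : nat -> nat) :
  0 <= x <= pi / 2 -> 0 <= y <= pi / 2 -> sin x != 0 -> cos x != cos y ->
  u 0%N = 2 * cos x -> v 0%N = 2 * cos y ->
  (forall m, u m.+1 = Num.sqrt (2 + e m * u m)) ->
  (forall m, v m.+1 = Num.sqrt (2 + e m * v m)) ->
  (forall n, (n <= M n)%N) -> (forall n, u (M n) = u 0%N) ->
  \prod_(0 <= l < M n) ((u l.+1 + v l.+1) / 2) @[n --> \oo]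
    --> (cos x - cos y) / ((y - x) * sin x).
Proof.
move=> x_bounds y_bounds sinx0 cosxy u0 v0 uS vS M_ge uM.
have yx0 : y - x != 0.
  by rewrite subr_eq0; apply: contra cosxy => /eqP->.
pose h n := sign_prod (M n) / 2 ^+ M n * (y - x).
have pow_neq0 n : (2 : R) ^+ n != 0 by rewrite expf_neq0.
have sign_neq0 m : sign_prod m != 0.
  by rewrite -sqrf_eq0 sign_prod_sqr oner_neq0.
have h_neq0 n : h n != 0 by rewrite !mulf_neq0// invr_neq0.
have h0 : h n @[n --> \oo] --> 0.
  apply: norm_cvg0.
  have geo : `|y - x| * 2^-1 ^+ n @[n --> \oo] --> (0 : R).
    rewrite -[X in _ --> X](mulr0 `|y - x|).
    apply: cvgM; first exact: cvg_cst.
    by apply: cvg_expr; rewrite ger0_norm; lra.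
  apply: squeeze_cvgr (cvg_cst 0) geo.
  apply: nearW => n; rewrite normr_ge0 /= /h normrM mulrC ler_wpM2l//.
  have -> : `|sign_prod (M n) / 2 ^+ M n| = 2^-1 ^+ M n.
    rewrite normrM normfV (ger0_norm (_ : 0 <= 2 ^+ _))// exprVn.
    suff -> : `|sign_prod (M n)| = 1 by rewrite mul1r.
    by have /eqP := sign_prod_sqr (M n); rewrite sqrf_eq1 => /orP[] /eqP->;
      rewrite ?normrN normr1.
  by rewrite ler_wiXn2l//; lra.
(* The angle stays in [0, pi / 2], where its cosine determines it. *)
have angle_x n : radical_angle x (M n) = x.
  have /andP[a0 a1] := radical_angle_bounds (M n) x_bounds.
  have pi0 := pi_gt0 R; move/andP: (x_bounds) => [x0 x1].
  apply: cos_inj; rewrite ?in_itv /=; try by apply/andP; split; lra.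
  have := radical_seq_cos x_bounds u0 uS (M n); rewrite uM u0; lra.
have vM n : v (M n) = 2 * cos (x + h n).
  rewrite (radical_seq_cos y_bounds v0 vS) /h -radical_angleB angle_x.
  by congr (2 * cos _); ring.
have tel n := radical_prod_telescope (sqr_radicalS x_bounds u0 uS)
  (sqr_radicalS y_bounds v0 vS) (M n).
have prodE n : \prod_(0 <= l < M n) ((u l.+1 + v l.+1) / 2) =
    (cos x - cos y) / ((y - x) * - ((cos (x + h n) - cos x) / h n)).
  have := tel n; rewrite uM u0 v0 vM => teln.
  have hE : h n = sign_prod (M n) * (y - x) / 2 ^+ M n by rewrite /h; field.
  have cos_neq : cos (x + h n) - cos x != 0.
    apply/eqP => c0; move: teln.
    have -> : 2 * cos x - 2 * cos (x + h n) = 0 by lra.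
    rewrite mulr0 mul0r => /esym/eqP; rewrite mulf_eq0 (negbTE (sign_neq0 _)) /=.
    by rewrite -mulrBr mulf_eq0 pnatr_eq0 /= subr_eq0 (negbTE cosxy).
  have := pow_neq0 (M n); have := sign_neq0 (M n).
  move: cos_neq teln; rewrite hE; move: (cos (x + _)) => c.
  move: (\prod_(_ <= _ < _) _) (sign_prod _) (2 ^+ _) => P S T cos_neq teln S0 T0.
  have cos_neqN : cos x - c != 0 by rewrite -opprB oppr_eq0.
  transitivity (T * (2 * cos x - 2 * c) * P / (2 * (T * (cos x - c)))).
    by field; rewrite cos_neqN T0.
  by rewrite teln; field; rewrite T0 yx0 S0 cos_neq cos_neqN.
rewrite (funext prodE).
apply: cvgM; first exact: cvg_cst.
apply: cvgV; first by rewrite mulf_neq0.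
apply: cvgM; first exact: cvg_cst.
rewrite -[X in _ --> X]opprK; apply: cvgN.
exact: cvg_cos_quotient.
Qed.

End Radicals.

(** * The periodic orbit of cosines *)

Section OddDenominator.
Variable R : realType.

Lemma sqr_cosD_pi_int (x : R) (a : int) : cos (x + a%:~R * pi) ^+ 2 = cos x ^+ 2.
Proof.
have Dn (y : R) n : cos (y + n%:R * pi) ^+ 2 = cos y ^+ 2.
  by rewrite mulr_natl (alternatingn (@cosDpi R)) exprMn sqrr_sign mul1r.
case: a => n; first exact: Dn.
by rewrite -(Dn _ n.+1) NegzE mulrNz mulNr addrNK.
Qed.

Lemma cos_odd_mul_eq0 (x : R) k : cos x = 0 -> cos ((2 * k + 1)%:R * x) = 0.
Proof.
move=> cosx0; elim: k => [|k IH]; first by rewrite mul1r.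
have -> : (2 * k.+1 + 1)%:R * x = (2 * k + 1)%:R * x + x *+ 2.
  by rewrite -[x *+ 2]mulr_natl -mulrDl -natrD; congr (_%:R * _); lia.
by rewrite cosD IH sin_mulr2n cosx0 !mul0r mul0rn mulr0 subr0.
Qed.

Variables (q : rat) (k t p : nat).
Hypothesis q_def : q = t%:R / (2 * k + 1)%:R.
Hypothesis p_gt0 : (0 < p)%N.
Hypothesis pow2_p : pow2_pm1 (2 * k + 1) p.
Notation c := (cos_pow2 R q).

Let m_neq0 : (2 * k + 1)%:R != 0 :> R.
Proof. by rewrite pnatr_eq0 addn1. Qed.

Lemma ratr_q : ratr q = t%:R / (2 * k + 1)%:R :> R.
Proof. by rewrite q_def fmorph_div /= !ratr_nat. Qed.

(** A zero of cos at an angle would persist at its odd multiple by 2k + 1, but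
    that multiple of 2 ^ i q pi is an integer multiple of pi. *)
Lemma cos_pow2_neq0 i : c i != 0.
Proof.
apply/eqP => /(cos_odd_mul_eq0 k).
have -> : (2 * k + 1)%:R * (2 ^+ i * ratr q * pi) =
    0 + (2 ^ i * t)%N%:Z%:~R * pi :> R.
  by rewrite ratr_q -pmulrn natrM natrX; field.
move=> /(congr1 (fun z => z ^+ 2)); rewrite sqr_cosD_pi_int cos0 => /eqP.
by rewrite expr0n expr1n oner_eq0.
Qed.

(** If 2 ^ p = s + b (2k + 1) with s = +-1, then
    2 ^ p q pi = s q pi + (b t) pi, and neither adding a multiple of pi nor
    changing the sign of the angle alters |cos|. *)
Lemma norm_cos_pow2_period : `|c p| = `|c 0|.
Proof.
rewrite -!sqrtr_sqr; congr Num.sqrt.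
have [b [s [s_sqr pE]]] : exists b s : int, s ^+ 2 = 1 /\
    2 ^+ p = s + b * (2 * k + 1)%:Z.
  by case: pow2_p => /eqP; rewrite eqz_mod_dvd => /dvdzP[b bE]; exists b;
    [exists 1 | exists (-1)]; split=> //; rewrite -bE; ring.
have pER : 2 ^+ p = s%:~R + b%:~R * (2 * k + 1)%:R :> R.
  by rewrite -[2]/(2%:~R) -rmorphXn /= pE rmorphD rmorphM.
have -> : c p = cos (s%:~R * (ratr q * pi) + (b * t)%:~R * pi).
  rewrite /cos_pow2 pER ratr_q; congr cos.
  by rewrite rmorphM /= -!pmulrn; field.
rewrite sqr_cosD_pi_int /cos_pow2 expr0 mul1r.
by move/eqP: s_sqr; rewrite sqrf_eq1 => /orP[] /eqP->;
  rewrite ?mulrNz ?mulNr ?cosN mul1r.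
Qed.

Lemma norm_cos_pow2E i : `|2 * c i| = Num.sqrt (2 + 2 * c i.+1).
Proof.
rewrite -sqrtr_sqr; congr Num.sqrt.
have -> : c i.+1 = cos ((2 ^+ i * ratr q * pi) *+ 2).
  by rewrite /cos_pow2 exprS -mulr_natr; congr cos; ring.
by rewrite cos_mulr2n -/(c i); ring.
Qed.

(** The values |2 c_i| in the order in which the product meets them: i runs down
    from p, and restarts there every p steps. *)
Definition cos_orbit l : R := `|2 * c (p - l %% p)|.

Definition orbit_sign l : R := radical_sign R q (p - l %% p).

(** The case i = p, where l %% p wraps around to 0, is where the periodicity
    |c_p| = |c_0| enters. *)
Lemma cos_orbitE n i : (i <= p)%N -> cos_orbit (n * p + i) = `|2 * c (p - i)|.
Proof.
rewrite /cos_orbit modnMDl leq_eqVlt => /orP[/eqP->|/modn_small->//].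
by rewrite modnn subn0 subnn !normrM norm_cos_pow2_period.
Qed.

Lemma orbit_sign_sqr l : orbit_sign l ^+ 2 = 1.
Proof.
rewrite /orbit_sign /radical_sign expr_div_n real_normK ?num_real// divff//.
by rewrite sqrf_eq0 cos_pow2_neq0.
Qed.

(** The sign of c_{i+1} times |2 c_{i+1}| is 2 c_{i+1}, so this is the half-angle
    formula for |2 c_i|. *)
Lemma cos_orbitS l :
  cos_orbit l.+1 = Num.sqrt (2 + orbit_sign l * cos_orbit l).
Proof.
have lt_p : (l %% p < p)%N by rewrite ltn_mod.
rewrite {1}(divn_eq l p) -addnS cos_orbitE// norm_cos_pow2E -subSn// subSS.
congr (Num.sqrt (2 + _)).
rewrite /orbit_sign /cos_orbit /radical_sign normrM ger0_norm//.
by field; rewrite normr_eq0 cos_pow2_neq0.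
Qed.

Variable s : nat -> R.
Hypothesis s_def : radical_seq q p s.

Lemma radical_seqS l : s l.+1 = Num.sqrt (2 + orbit_sign l * s l).
Proof.
have lt_p : (l %% p < p)%N by rewrite ltn_mod.
case: s_def => _ /(_ (l %/ p)%N (l %% p).+1); rewrite /= lt_p => /(_ isT).
by rewrite addnS subn1 addn1 subSS mulnC -divn_eq.
Qed.

Lemma partial_productE N : partial_product q p s N =
  \prod_(0 <= l < N.+1 * p) ((cos_orbit l.+1 + s l.+1) / 2).
Proof.
rewrite big_nat_mul; apply: eq_bigr => i _.
rewrite -{1}[(i * p)%N]add0n big_addn mulSn addnK big_add1 /=.
apply: eq_big_nat => j /andP[_ lt_jp].
by rewrite [(j + i * p)%N]addnC -addnS cos_orbitE// (mulnC p).
Qed.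

End OddDenominator.

(** * Evaluation of the product *)

Theorem theorem7 (R : realType) (q : rat) (k t p : nat) (s : nat -> R)
    (q_bounds : 0 < q < 1 / 2)
    (k_ge1 : (1 <= k)%N) (t_bounds : (1 <= t <= k)%N)
    (lowest_terms : coprime t (2 * k + 1))
    (q_def : q = t%:R / (2 * k + 1)%:R)
    (p_def : min_pow2_pm1 (2 * k + 1) p)
    (s_def : radical_seq q p s) :
  cvgn (partial_product q p s) /\
  1 / pi * (2 * cos (2 * ratr q * pi)
              / ((1 - 4 * ratr q) * sin (ratr q * pi))) =
  (2 * cos (ratr q * pi) + Num.sqrt 2) / 2 * limn (partial_product q p s) :> R.
Proof.
have [p_gt0 pow2_p _] := p_def.
have pi0 := pi_gt0 R.
have [q_gt0 q_lt] : 0 < ratr q :> R /\ ratr q < 1 / 2 :> R.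
  case/andP: q_bounds => q0 q1; split; first by rewrite ltr0q.
  by rewrite -[X in _ < X](_ : ratr (1 / 2) = _) ?ltr_rat// fmorph_div rmorph1 ratr_nat.
have [x_gt0 x_lt] : 0 < ratr q * pi :> R /\ ratr q * pi < pi / 2 :> R.
  by split; [rewrite mulr_gt0 | rewrite [pi / 2]mulrC ltr_pM2r //; lra].
have c0E : cos_pow2 R q 0 = cos (ratr q * pi) by rewrite /cos_pow2 expr0 mul1r.
have c1_neq0 : cos (2 * ratr q * pi) != 0 :> R.
  exact: (cos_pow2_neq0 R q_def 1).
have cos2E : cos (2 * ratr q * pi) = 2 * cos (ratr q * pi) ^+ 2 - 1 :> R.
  have -> : 2 * ratr q * pi = ratr q * pi *+ 2 :> R by rewrite -mulr_natr; ring.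
  by rewrite cos_mulr2n mulr_natl.
have sqrt2E : Num.sqrt 2 = 2 * cos (pi / 4) :> R.
  have := @sqrt_two_cos R (pi / 2); rewrite cos_pihalf mulr0 addr0 => ->.
    by congr (2 * cos _); field.
  by apply/andP; split; lra.
have cos_pi4 : cos (pi / 4) ^+ 2 = 1 / 2 :> R.
  by have : Num.sqrt 2 ^+ 2 = 2 :> R; [rewrite sqr_sqrtr | rewrite sqrt2E; lra].
(* Both orbits starting at the same point would force c_1 = 0, by duplication. *)
have cos_neq : cos (ratr q * pi) != cos (pi / 4) :> R.
  apply: contra c1_neq0 => /eqP cE; rewrite cos2E cE cos_pi4; apply/eqP; lra.
have q_neq : 1 - 4 * ratr q != 0 :> R.
  apply: contra cos_neq => /eqP qE; apply/eqP; congr cos.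
  by rewrite (_ : ratr q = 1 / 4) ?mul1r ?[pi / 4]mulrC //; lra.
have sin_neq0 : sin (ratr q * pi) != 0 :> R.
  by rewrite gt_eqF// sin_gt0_pi//; apply/andP; split; lra.
have lim_prod : (partial_product q p s n @[n --> \oo] -->
    (cos (ratr q * pi) - cos (pi / 4)) /
      ((pi / 4 - ratr q * pi) * sin (ratr q * pi)))%classic.
  rewrite (funext (partial_productE q_def pow2_p s)).
  have orbit0 n : cos_orbit R q p (n * p) = 2 * cos (ratr q * pi).
    rewrite -[(n * p)%N]addn0 (cos_orbitE R q_def pow2_p)// subn0.
    rewrite normrM (norm_cos_pow2_period R q_def pow2_p) -normrM c0E ger0_norm//.
    by rewrite mulr_ge0// cos_ge0_pihalf//; apply/andP; split; lra.
  apply: (cvg_radical_prod (e := orbit_sign R q p)) => //.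
  - exact: (orbit_sign_sqr R p q_def).
  - by apply/andP; split; lra.
  - by apply/andP; split; lra.
  - exact: (orbit0 0%N).
  - by case: s_def => -> _.
  - exact: (cos_orbitS R q_def p_gt0 pow2_p).
  - exact: (radical_seqS p_gt0 s_def).
  - by move=> n; rewrite (leq_trans (leqnSn n))// leq_pmulr.
  - by move=> n; rewrite orbit0; exact/esym/(orbit0 0%N).
split; first by apply/cvg_ex; eexists; exact: lim_prod.
rewrite (cvg_lim _ lim_prod)// sqrt2E.
have -> : 2 * cos (2 * ratr q * pi) =
    4 * ((cos (ratr q * pi) + cos (pi / 4)) * (cos (ratr q * pi) - cos (pi / 4))) :> R.
  transitivity (4 * (cos (ratr q * pi) ^+ 2 - cos (pi / 4) ^+ 2) : R); last by ring.
  by rewrite cos2E cos_pi4; field.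
(* Left concrete, pi would be unfolded by field to the double of the zero of cos
   that defines it. *)
move: pi0 sin_neq0 q_neq; move: (sin _) (cos _) (cos _) => S C D.
move: pi (ratr q) => P Q P_gt0 S_neq0 Q_neq.
have P_neq0 : P != 0 by rewrite gt_eqF.
field.
have -> : P + - (Q * P) * 4 = P * (1 - 4 * Q) by ring.
by rewrite mulf_neq0 // S_neq0 Q_neq P_neq0.
Qed.
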